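(* Let $\Lambda$ be a finite dimensional algebra over a field. If the torsion class in $\mathrm{mod}\,\Lambda$ generated by all finitely generated injective $\Lambda$-modules contains all finitely generated $\Lambda$-modules, then $\operatorname{Findim}\Lambda<\infty$.
   Context: $\mathrm{mod}\,\Lambda$ is the category of finitely generated right $\Lambda$-modules. The torsion class generated by a class of modules is the smallest full subcategory of $\mathrm{mod}\,\Lambda$ containing it and closed under isomorphisms, quotients, extensions and finite direct sums. $\operatorname{Findim}\Lambda$ is the supremum of the projective dimensions of all (not necessarily finitely generated) right $\Lambda$-modules of finite projective dimension. *)

(* Defs.v *)
From HB Require Import structures.
From mathcomp Require Import all_boot all_order all_algebra all_field.

Set Implicit Arguments.
Unset Strict Implicit.
Unset Printing Implicit Defensive.

Import GRing.Theory.
Local Open Scope ring_scope.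

(* A right module over a ring A is a left module over the converse ring A^c:
   there a *: (b *: m) = (b * a) *: m, which reads (m b) a = m (b a). *)
Notation rmodType A := (lmodType A^c).

Section Modules.
Variable R : pzRingType.
Implicit Types L M N P I : lmodType R.

Definition surj M N (f : M -> N) : Prop := forall y, exists x, f x = y.

Definition exact_at L M N (f : L -> M) (g : M -> N) : Prop :=
  forall y, g y = 0 <-> exists x, f x = y.

Definition zero_module M : Prop := forall x : M, x = 0.

Definition fin_gen M : Prop :=
  exists (n : nat) (g : 'I_n -> M),
    forall x, exists c : 'I_n -> R, x = \sum_(i < n) c i *: g i.

Definition projective P : Prop :=
  forall M N (f : {linear M -> N}) (g : {linear P -> N}),
    surj f -> exists h : {linear P -> M}, forall x, f (h x) = g x.

Definition injective_module I : Prop :=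
  forall M N (f : {linear M -> N}) (g : {linear M -> I}),
    injective f -> exists h : {linear N -> I}, forall x, h (f x) = g x.

(* There is an exact sequence 0 -> P n -> ... -> P 1 -> P 0 -> M -> 0 with all
   P i projective; it is indexed by nat, with P i = 0 for i > n. *)
Definition has_proj_resolution M (n : nat) : Prop :=
  exists (P : nat -> lmodType R)
         (d : forall i, {linear P i.+1 -> P i})
         (e : {linear P 0%N -> M}),
    [/\ forall i, projective (P i),
        surj e,
        exact_at (d 0%N) e,
        forall i, exact_at (d i.+1) (d i)
      & forall i, (n < i)%N -> zero_module (P i)].

(* M has finite projective dimension, equal to n. With this convention the
   zero module has projective dimension 0. *)
Definition proj_dim_eq M (n : nat) : Prop :=
  has_proj_resolution M n /\
  forall m, has_proj_resolution M m -> (n <= m)%N.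

(* Findim <= d, the supremum being taken over all modules, not only the
   finitely generated ones. *)
Definition Findim_le (d : nat) : Prop :=
  forall M n, proj_dim_eq M n -> (n <= d)%N.

(* Finite direct sums are the empty one (the zero module) and the binary ones. *)
Record torsion_class (C : lmodType R -> Prop) : Prop := TorsionClass {
  torsion_fin_gen : forall M, C M -> fin_gen M;
  torsion_iso : forall M N (f : {linear M -> N}), bijective f -> C M -> C N;
  torsion_quo : forall M N (f : {linear M -> N}), surj f -> C M -> C N;
  torsion_ext : forall L M N (f : {linear L -> M}) (g : {linear M -> N}),
    injective f -> exact_at f g -> surj g -> C L -> C N -> C M;
  torsion_sum0 : forall M, zero_module M -> C M;
  torsion_sum : forall M N, C M -> C N -> C (M * N)%type
}.

Definition generated_torsion_class (X : lmodType R -> Prop) M : Prop :=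
  forall C, torsion_class C -> (forall N, X N -> C N) -> C M.

End Modules.

(* Main.v *)
From HB Require Import structures.
From mathcomp Require Import boolp classical_sets functions.
Require Import Defs.
From mathcomp Require Import all_boot all_order all_algebra all_field.

(** The hypothesis forces [Findim A = 0].  Suppose [M] has projective dimension
    [n + 1], and let [d : P -> Q] be the last map of a projective resolution of
    that length.  Since [Ext^(n+1)(M, -)] is right exact, the modules on which
    it vanishes are closed under quotients and extensions, and they contain the
    injectives; hence [Ext^(n+1)(M, A) = 0], that is, every map [P -> A] extends
    along [d].  The same then holds for maps to powers [A^T].  As [A] is finite
    dimensional, [A^T] is [K^T] tensored with [A], so a [K]-linear surjection
    [K^P -> P] makes [P] a quotient, hence a direct summand, of [A^P].  So the
    identity of [P] extends along [d], and the resolution can be shortened. *)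

Set Implicit Arguments.
Unset Strict Implicit.
Unset Printing Implicit Defensive.

Import GRing.Theory.
Local Open Scope ring_scope.

(** Bundles a bare function, typically one obtained by choice, with its linearity. *)
Lemma linear_of_fun (S : pzRingType) (U V : lmodType S) (f : U -> V) :
  linear f -> exists g : {linear U -> V}, g =1 f.
Proof.
move=> lf; pose m := GRing.isLinear.Build _ _ _ _ f lf.
pose g : {linear U -> V} := HB.pack f m.
by exists g.
Qed.

(** * Extension of partial linear maps between vector spaces *)

Section LinearExtension.
Variables (K : fieldType) (V W : lmodType K).
Implicit Types (G : set (V * W)).

(** A partial linear map, encoded by its graph; by linearity, single-valuedness need only be asked
    at 0. *)
Definition linear_graph G :=
  [/\ G 0, forall k p q, G p -> G q -> G (k *: p + q)
    & forall w, G (0, w) -> w = 0].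

Lemma linear_graph_scale G k p : linear_graph G -> G p -> G (k *: p).
Proof. by move=> [G0 Gl _] Gp; rewrite -[_ *: _]addr0; exact: Gl. Qed.

Lemma linear_graph_sub G p q : linear_graph G -> G p -> G q -> G (q - p).
Proof. by move=> [_ Gl _] Gp Gq; rewrite addrC -scaleN1r; exact: Gl. Qed.

Lemma linear_graph_fun G v w w' :
  linear_graph G -> G (v, w) -> G (v, w') -> w = w'.
Proof.
move=> Gg Gw Gw'; apply/eqP; rewrite -subr_eq0; apply/eqP.
have [_ _] := Gg; apply.
by have := linear_graph_sub Gg Gw' Gw; rewrite /GRing.add /= /add_pair /= subrr.
Qed.

(** For [v] outside the domain, this is the extension to the span of the domain and [v] with value 0
    at [v]. *)
Definition graph_adjoin G (v : V) : set (V * W) :=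
  fun p => exists k, G (p - (k *: v, 0)).

Lemma graph_adjoin_linear G v :
  linear_graph G -> ~ (exists w, G (v, w)) -> linear_graph (graph_adjoin G v).
Proof.
move=> Gg Gv; have [G0 Gl G0w] := Gg; split.
- by exists 0; rewrite scale0r subr0.
- move=> k p q [a Ga] [b Gb]; exists (k * a + b).
  suff -> : k *: p + q - ((k * a + b) *: v, 0)
            = k *: (p - (a *: v, 0)) + (q - (b *: v, 0)) by exact: Gl.
  have -> : ((k * a + b) *: v, 0) = k *: (a *: v, 0) + (b *: v, 0) :> V * W.
    by apply: injective_projections; rewrite /= ?scaler0 ?addr0 // scalerA -scalerDl.
  by rewrite scalerBr opprD addrACA.
- move=> w [k Gk]; have [k0|k0] := eqVneq k 0.
    by move: Gk; rewrite k0 scale0r subr0; exact: G0w.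
  (* Here [(- k v, w)] lies in [G], so [v] was already in the domain, with value [- k^-1 w]. *)
  case: Gv; exists (- k^-1 *: w).
  have := linear_graph_scale (- k^-1) Gg Gk; congr G.
  apply: injective_projections => /=.
    by rewrite sub0r scalerN scaleNr opprK scalerA mulVf // scale1r.
  by rewrite subr0.
Qed.

Lemma linear_extension G0 : linear_graph G0 ->
  exists f : {linear V -> W}, forall v w, G0 (v, w) -> f v = w.
Proof.
move=> G0g.
(* The empty chain has empty union, which is not a linear graph; adding [G0] to every member repairs
   this and forces the maximal graph to extend [G0]. *)
have [F FP Ftot|G [Gg Gmax]] :=
    @Zorn_bigcup _ (fun G => linear_graph (G0 `|` G)%classic).
  have sub X p : F X -> (G0 `|` X)%classic p ->
      (G0 `|` \bigcup_(X in F) X)%classic p.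
    by move=> FX [|Xp]; [left|right; exists X].
  split; first by left; case: G0g.
    move=> k p q [G0p|[X FX Xp]] [G0q|[Y FY Yq]].
    + by left; case: G0g => _ + _; apply.
    + by apply: (sub Y) => //; case: (FP _ FY) => _ + _; apply; [left|right].
    + by apply: (sub X) => //; case: (FP _ FX) => _ + _; apply; [right|left].
    + case: (Ftot _ _ FX FY) => [/(_ _ Xp) Yp|/(_ _ Yq) Xq].
        by apply: (sub Y) => //; case: (FP _ FY) => _ + _; apply; right.
      by apply: (sub X) => //; case: (FP _ FX) => _ + _; apply; right.
  move=> w [G0w|[X FX Xw]]; first by case: G0g => _ _; apply.
  by case: (FP _ FX) => _ _; apply; right.
set H := (G0 `|` G)%classic in Gg.
have Htot v : exists w, H (v, w).
  apply: contrapT => nHv; have adj := graph_adjoin_linear Gg nHv.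
  have subH p : H p -> graph_adjoin H v p.
    by exists 0; rewrite scale0r subr0.
  (* Maximality is contradicted: the adjoined graph contains [G] and also [(v, 0)], which is not in
     [G]. *)
  apply: (Gmax (graph_adjoin H v)); last first.
    rewrite setUidr //; move=> p G0p; apply: subH; by left.
  split; first by move=> p Gp; apply: subH; right.
  move=> /(_ (v, 0)) vG; apply: nHv; exists 0; right; apply: vG.
  by exists 1; rewrite scale1r subrr; case: Gg.
have [f Hf] := choice Htot.
have [|g gf] := @linear_of_fun _ _ _ f.
  move=> k u v; apply: (linear_graph_fun Gg (Hf _)).
  have [_ Gl _] := Gg.
  exact: (Gl k (u, f u) (v, f v)).
exists g => v w G0vw; rewrite gf; apply: (linear_graph_fun Gg (Hf v)); by left.
Qed.

End LinearExtension.

(** * A vector space [W] as a quotient of [K^W] *)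

Section DeltaExtension.
Variables (K : fieldType) (W : lmodType K).

(** The graph of the map sending a finitely supported [g] to the sum of all [g x *: x]; [s] is any
    finite set containing the support. *)
Definition finsupp_graph : set ((W -> K^o) * W) :=
  fun p => exists2 s : seq W, uniq s &
    (forall x, x \notin s -> p.1 x = 0) /\ p.2 = \sum_(x <- s) p.1 x *: x.

(** Enlarging [s] does not change the value, so two functions can be added over a common finite
    set. *)
Lemma finsupp_sum_sub (g : W -> K^o) (s t : seq W) : uniq s -> uniq t ->
  {subset s <= t} -> (forall x, x \notin s -> g x = 0) ->
  \sum_(x <- s) g x *: x = \sum_(x <- t) g x *: x.
Proof.
move=> us ut st g0; rewrite [RHS](bigID (mem s)) /= [X in _ + X]big1 ?addr0.
  rewrite -[RHS]big_filter; apply: perm_big; apply: uniq_perm => //.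
    by rewrite filter_uniq.
  by move=> x; rewrite mem_filter; apply/idP/andP => [xs|[]//]; split=> //; exact: st.
by move=> x /g0 ->; rewrite scale0r.
Qed.

Lemma finsupp_graph_linear : @linear_graph K (W -> K^o) W finsupp_graph.
Proof.
split.
- by exists [::] => //; split=> //; rewrite big_nil.
- move=> k [g v] [h w] [s us [/= g0 ->]] [t ut [/= h0 ->]].
  exists (undup (s ++ t)); first exact: undup_uniq.
  split=> [x|] /=.
    rewrite mem_undup mem_cat negb_or => /andP[/g0 gx /h0 hx].
    have -> : (k *: g + h) x = k * g x + h x by [].
    by rewrite gx hx mulr0 addr0.
  rewrite (finsupp_sum_sub us (undup_uniq (s ++ t)) _ g0); last first.
    by move=> x xs; rewrite mem_undup mem_cat xs.
  rewrite (finsupp_sum_sub ut (undup_uniq (s ++ t)) _ h0); last first.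
    by move=> x xs; rewrite mem_undup mem_cat xs orbT.
  rewrite scaler_sumr -big_split /=; apply: eq_bigr => x _.
  by rewrite scalerA -scalerDl.
- by move=> w [s _ [_ /= ->]]; rewrite big1 // => x _; rewrite scale0r.
Qed.

(** The summation map makes sense on finitely supported functions only and is extended to all of
    [K^W]; indicators of points show that it is onto. *)
Lemma vector_space_quotient_of_power :
  exists theta : {linear (W -> K^o) -> W},
    forall w, theta (fun x => (x == w)%:R) = w.
Proof.
have [f fP] := linear_extension finsupp_graph_linear; exists f => w; apply: fP.
exists [:: w] => //; split=> [x|] /=; first by rewrite inE => /negbTE ->.
by rewrite big_seq1 eqxx scale1r.
Qed.

End DeltaExtension.

(** * A module [M] as a quotient of the power [A^M] *)

Section RestrictionOfScalars.
Variables (K : fieldType) (A : falgType K).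

(** An alias of [M] that carries the [K]-structure apart from the [A^c]-structure. *)
Definition restrict_scalars (M : rmodType A) : Type := M.

Variable M : rmodType A.
HB.instance Definition _ := GRing.Zmodule.on (restrict_scalars M).

Definition restricted_scale (k : K) (m : restrict_scalars M) :
  restrict_scalars M := (k%:A : A^c) *: (m : M).

Fact restricted_scaleA a b v :
  restricted_scale a (restricted_scale b v) = restricted_scale (a * b) v.
Proof.
rewrite /restricted_scale.
have -> : (a * b)%:A = (a%:A : A^c) * b%:A.
  by rewrite [RHS](mulr_algr a (b%:A : A)) scalerA.
by rewrite -scalerA.
Qed.

Fact restricted_scale1 : left_id 1 restricted_scale.
Proof. by move=> v; rewrite /restricted_scale !scale1r. Qed.

Fact restricted_scaleDr : right_distributive restricted_scale +%R.
Proof. by move=> a u v; rewrite /restricted_scale scalerDr. Qed.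

Fact restricted_scaleDl v : {morph restricted_scale^~ v : a b / a + b}.
Proof.
move=> a b; rewrite /restricted_scale.
have -> : (a + b)%:A = (a%:A : A^c) + b%:A by exact: scalerDl.
exact: scalerDl.
Qed.

HB.instance Definition _ := GRing.Zmodule_isLmodule.Build K (restrict_scalars M)
  restricted_scaleA restricted_scale1 restricted_scaleDr restricted_scaleDl.

Lemma module_quotient_of_power :
  exists Pi : {linear (M -> (A^c)^o) -> M}, surj Pi.
Proof.
have [theta thetaP] := vector_space_quotient_of_power (restrict_scalars M).
pose e := vbasis {:A}; pose c j (f : M -> (A^c)^o) : M -> K^o :=
  fun x => coord e j (f x : A).
have eE (a : A) : a = \sum_j coord e j a *: e`_j.
  exact: (coord_vbasis (memvf a)).
(* The [A]-linear extension of [theta]: [f] is the sum of its coordinate functions [c j f] tensored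
   with the basis vectors. *)
pose F (f : M -> (A^c)^o) : M :=
  \sum_(j < \dim {:A}) (e`_j : A^c) *: (theta (c j f) : M).
have scaleE k b (m : restrict_scalars M) :
    (b : A^c) *: (k *: m : M) = ((k *: b : A) : A^c) *: (m : M).
  rewrite [k *: m]/GRing.scale /= /restricted_scale scalerA.
  by congr (_ *: _); rewrite /GRing.mul /= mulr_algl.
have [|Pi PiF] := @linear_of_fun _ _ _ F.
  (* Scaling by [a] in [A^c] is right multiplication by [a] in [A]; [t] is its matrix in the basis
     [e]. *)
  move=> a f g; pose t (j l : 'I_(\dim {:A})) := coord e l (e`_j * a : A).
  have cE l : c l (a *: f + g) = \sum_j t j l *: c j f + c l g.
    apply/funext => x; transitivity (coord e l ((f x : A) * a + g x)) => //.
    transitivity ((\sum_j t j l *: c j f) x + c l g x) => //; rewrite fct_sumE.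
    rewrite linearD; congr (_ + _); rewrite {1}(eE (f x)) mulr_suml linear_sum.
    apply: eq_bigr => j _; rewrite -scalerAl linearZ /=.
    by rewrite mulrC.
  rewrite /F; under eq_bigr => l _.
    rewrite cE linearD linear_sum scalerDr scaler_sumr.
    over.
  rewrite big_split /=; congr (_ + _); rewrite exchange_big scaler_sumr /=.
  apply: eq_bigr => j _; rewrite scalerA.
  have -> : (a : A^c) * (e`_j : A^c) = \sum_(l < \dim {:A}) ((t j l *: e`_l : A) : A^c).
    exact: eE.
  rewrite scaler_suml; apply: eq_bigr => l _.
  by rewrite linearZ scaleE.
(* The indicator of [y] is a preimage: [theta] sends its coordinates to the multiples of [y] by the
   coordinates of [1], which recombine to [1 *: y]. *)
exists Pi => y; exists (fun x => ((x == y)%:R : A)); rewrite PiF /F.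
have cE j : c j (fun x => ((x == y)%:R : A)) =
    coord e j (1 : A) *: (fun x => (x == y)%:R).
  apply/funext => x; transitivity (coord e j (1 : A) * (x == y)%:R) => //.
  by rewrite /c; case: (x == y); rewrite ?mulr1 // linear0 mulr0.
under eq_bigr => j _.
  rewrite cE linearZ thetaP /= scaleE.
  over.
rewrite -scaler_suml -[RHS]scale1r; congr (_ *: _).
exact: esym (eE 1).
Qed.

End RestrictionOfScalars.

(** * The torsion class of modules to which maps extend along [d] *)

Section TorsionClass.
Variables (S : pzRingType) (P Q : lmodType S) (d : {linear P -> Q}).

(** When [d] is the last map of a projective resolution of [M] of length [n + 1], this says that
    [Ext^(n+1)(M, X)] vanishes. *)
Definition extends_along (X : lmodType S) : Prop :=
  forall f : {linear P -> X}, exists h : {linear Q -> X}, forall x, h (d x) = f x.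

(** Lift the map to [X] by projectivity of [P], extend it there, and push it back to [Y]. *)
Lemma extends_along_quo (X Y : lmodType S) (p : {linear X -> Y}) :
  projective P -> surj p -> extends_along X -> extends_along Y.
Proof.
move=> projP sp EX f; have [f' f'E] := projP _ _ p f sp.
have [h hE] := EX f'; exists (p \o h : {linear Q -> Y}) => x /=.
by rewrite hE.
Qed.

(** Extend [p \o f] to [Q -> N] and lift it to [h' : Q -> X]. The error [f - h' \o d] lands in [L];
    extending it as well gives the correction to [h']. *)
Lemma extends_along_ext (L X N : lmodType S)
    (i : {linear L -> X}) (p : {linear X -> N}) :
  projective Q -> injective i -> exact_at i p -> surj p ->
  extends_along L -> extends_along N -> extends_along X.
Proof.
move=> projQ inji ex sp EL EN f.
have [h hE] := EN (p \o f : {linear P -> N}).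
have [h' h'E] := projQ _ _ p h sp.
have rP x : exists l, i l = f x - h' (d x).
  by apply/ex; rewrite linearB h'E hE subrr.
have [r rE] := choice rP.
have [|r' r'E] := @linear_of_fun _ _ _ r.
  move=> a x y; apply: inji; rewrite linearP !rE.
  rewrite (linearP f) (linearP d) (linearP h') /=.
  by rewrite scalerBr opprD addrACA.
have [k kE] := EL r'.
exists ((i \o k) \+ h' : {linear Q -> X}) => x /=.
by rewrite kE r'E rE subrK.
Qed.

Lemma fin_gen_quo (X Y : lmodType S) (p : {linear X -> Y}) :
  surj p -> fin_gen X -> fin_gen Y.
Proof.
move=> sp [n [g gP]]; exists n, (p \o g) => y; have [x <-] := sp y.
have [c ->] := gP x; exists c; rewrite linear_sum.
by apply: eq_bigr => j _; rewrite linearZ.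
Qed.

Lemma fin_gen_ext (L X N : lmodType S)
    (i : {linear L -> X}) (p : {linear X -> N}) :
  exact_at i p -> surj p -> fin_gen L -> fin_gen N -> fin_gen X.
Proof.
move=> ex sp [m [g gP]] [n [h hP]].
have [h' h'E] := choice (fun j => sp (h j)).
exists (m + n)%N, (fun j => match split j with inl a => i (g a) | inr b => h' b end).
move=> x; have [c cE] := hP (p x).
have /ex[l lE] : p (x - \sum_j c j *: h' j) = 0.
  rewrite linearB linear_sum cE; apply/eqP; rewrite subr_eq0; apply/eqP.
  by apply: eq_bigr => j _; rewrite linearZ /= h'E.
have [b bE] := gP l.
exists (fun j => match split j with inl a => b a | inr a => c a end).
rewrite big_split_ord /=.
under eq_bigr => j _ do rewrite (unsplitK (inl j)).
under [X in _ + X]eq_bigr => j _ do rewrite (unsplitK (inr j)).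
apply/eqP; rewrite -subr_eq -lE bE linear_sum; apply/eqP.
by apply: eq_bigr => j _; rewrite linearZ.
Qed.

Lemma extends_along_torsion : projective P -> projective Q ->
  torsion_class (fun X => fin_gen X /\ extends_along X).
Proof.
move=> projP projQ.
have quo (X Y : lmodType S) (p : {linear X -> Y}) : surj p ->
    fin_gen X /\ extends_along X -> fin_gen Y /\ extends_along Y.
  move=> sp [gX EX]; split; first exact: fin_gen_quo sp gX.
  exact: extends_along_quo sp EX.
have ext (L X N : lmodType S) (i : {linear L -> X}) (p : {linear X -> N}) :
    injective i -> exact_at i p -> surj p ->
    fin_gen L /\ extends_along L -> fin_gen N /\ extends_along N ->
    fin_gen X /\ extends_along X.
  move=> ii ex sp [gL EL] [gN EN]; split; first exact: fin_gen_ext ex sp gL gN.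
  exact: extends_along_ext ii ex sp EL EN.
split=> //.
- by move=> X [].
- by move=> X Y f [g _ fg]; apply: (quo _ _ f) => y; exists (g y).
- move=> X X0; split.
    exists 0%N, (fun _ => 0) => x; exists (fun _ => 0).
    by rewrite big_ord0 (X0 x).
  by move=> f; exists (\0 : {linear Q -> X}) => x; rewrite (X0 (f x)).
(* The direct sum is handled as the split extension of [Y] by [X]. *)
- move=> X Y CX CY.
  have [|i iE] := @linear_of_fun S X (X * Y)%type (fun x => (x, 0)).
    move=> a x y; apply: injective_projections => //=.
    by rewrite scaler0 addr0.
  have [|p pE] := @linear_of_fun S (X * Y)%type Y snd; first by [].
  apply: (ext _ _ _ i p) => //.
  + by move=> x y; rewrite !iE => -[].
  + move=> [x y]; rewrite pE; split=> /= [->|[x']]; first by exists x.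
    by rewrite iE => -[_ <-].
  + by move=> y; exists (0, y); rewrite pE.
Qed.

End TorsionClass.

(** * The regular module, and splitting of [d] *)

Lemma fin_gen_regular (S : pzRingType) : fin_gen (S^o : lmodType S).
Proof.
exists 1%N, (fun _ => 1) => x; exists (fun _ => x).
by rewrite big_ord1 /GRing.scale /= mulr1.
Qed.

(** A section [s] of [Pi] embeds [P] in [A^P]. Each coordinate of [s] extends along [d]; together
    the extensions form a map [Q -> A^P], and following it by [Pi] gives the retraction. *)
Lemma retraction_of_extends_along_regular (K : fieldType) (A : falgType K)
    (P Q : rmodType A) (d : {linear P -> Q}) :
  projective P -> extends_along d (A^c)^o ->
  exists h : {linear Q -> P}, cancel d h.
Proof.
move=> projP EA; have [Pi sPi] := module_quotient_of_power P.
have [s sE] := projP _ _ Pi idfun sPi.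
have hP (t : P) : exists h : {linear Q -> (A^c)^o}, forall x, h (d x) = s x t.
  have [|f fE] := @linear_of_fun _ _ ((A^c)^o : rmodType A) (fun x => s x t).
    by move=> a x y; rewrite linearP.
  by have [h hE] := EA f; exists h => x; rewrite hE fE.
have [h hE] := choice hP.
have [|h' h'E] := @linear_of_fun _ Q (P -> (A^c)^o) (fun y t => h t y).
  by move=> a x y; apply/funext => t; rewrite linearP.
exists (Pi \o h' : {linear Q -> P}) => x /=.
rewrite h'E -[RHS]sE; congr (Pi _); apply/funext => t; exact: hE.
Qed.

(** * Kernels as modules, and summands cut out by idempotents *)

Section Kernel.
Variables (S : pzRingType) (M N : lmodType S) (f : {linear M -> N}).

Definition ker_pred : {pred M} := fun x => f x == 0.

Fact ker_submod_closed : submod_closed ker_pred.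
Proof.
split=> [|a x y]; rewrite /ker_pred !unfold_in ?linear0 // => /eqP fx /eqP fy.
by rewrite linearP fx fy scaler0 addr0.
Qed.

HB.instance Definition _ := GRing.isSubmodClosed.Build S M ker_pred
  ker_submod_closed.

Record kernel := Kernel { kernel_val :> M; _ : kernel_val \in ker_pred }.

HB.instance Definition _ := [isSub for kernel_val].
HB.instance Definition _ := [Choice of kernel by <:].
HB.instance Definition _ := [SubChoice_isSubLmodule of kernel by <:].

End Kernel.

Lemma kernelP (S : pzRingType) (M N : lmodType S) (f : {linear M -> N})
  (x : kernel f) : f (val x) = 0.
Proof. exact/eqP/(valP x). Qed.

(** For an idempotent [g], the map [1 - g] projects onto the kernel, which is thus a direct
    summand. *)
Lemma kernel_projection (S : pzRingType) (M : lmodType S) (g : {linear M -> M}) :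
  (forall x, g (g x) = g x) ->
  exists p : {linear M -> kernel g}, forall x, val (p x) = x - g x.
Proof.
move=> gg; have gp x : x - g x \in ker_pred g.
  by rewrite unfold_in linearB gg subrr.
have [|p pE] := @linear_of_fun _ M (kernel g) (fun x => Kernel (gp x)).
  move=> a x y; apply: val_inj; rewrite [RHS]linearP /= linearP.
  by rewrite opprD scalerBr addrACA.
by exists p => x; rewrite pE.
Qed.

Lemma kernel_inclusion (S : pzRingType) (M N : lmodType S) (f : {linear M -> N}) :
  exists i : {linear kernel f -> M}, forall x, i x = val x.
Proof. by apply: linear_of_fun => a x y; rewrite linearP. Qed.

Lemma projective_retract (S : pzRingType) (P P' : lmodType S)
    (i : {linear P' -> P}) (p : {linear P -> P'}) :
  cancel i p -> projective P -> projective P'.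
Proof.
move=> ip projP M N f g sf.
have [h hE] := projP M N f (g \o p : {linear P -> N}) sf.
by exists (h \o i : {linear P' -> M}) => x /=; rewrite hE /= ip.
Qed.

(** * Shortening a resolution whose last map splits *)

Section Truncation.
Variables (S : pzRingType) (M : lmodType S) (n : nat).
Variables (P : nat -> lmodType S) (d : forall i, {linear P i.+1 -> P i}).
Variables (e : {linear P 0%N -> M}) (h : {linear P n -> P n.+1}).
Hypotheses (projP : forall i, projective (P i)) (surj_e : surj e).
Hypotheses (exact_e : exact_at (d 0%N) e).
Hypotheses (exact_d : forall i, exact_at (d i.+1) (d i)) (hK : cancel (d n) h).

(* Uniform in [i], so that no cast between [P i] and [P n] is needed: [g] is [0]
   below [n], [d n \o h] at [n] and the identity above [n]. *)
Definition truncation_idempotent i (g : {linear P i -> P i}) : Prop :=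
  [/\ forall x, g (g x) = g x,
      (i < n)%N -> forall x, g x = 0,
      (i <= n)%N -> forall x, exists w, g x = d i w,
      (n <= i)%N -> forall w, g (d i w) = d i w
    & (n < i)%N -> forall x, g x = x].

Lemma truncation_idempotent_ex i : exists g, @truncation_idempotent i g.
Proof.
have [lt_in|lt_ni|eq_in] := ltngtP i n.
- exists (\0 : {linear P i -> P i}); split=> //.
  + by move=> _ x; exists 0; rewrite linear0.
  + by rewrite leqNgt lt_in.
  + by rewrite ltnNge ltnW.
- exists (idfun : {linear P i -> P i}); split=> //.
  + by rewrite ltnNge ltnW.
  + by rewrite leqNgt lt_ni.
- subst i; exists (d n \o h : {linear P n -> P n}); split=> /=.
  + by move=> x; rewrite hK.
  + by rewrite ltnn.
  + by move=> _ x; exists (h x).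
  + by move=> _ w; rewrite hK.
  + by rewrite ltnn.
Qed.

(** Each [P i] is replaced by the kernel of its idempotent: all of [P i] below [n], a complement of
    the image of [d n] in degree [n], and zero above. *)
Lemma truncate_resolution : has_proj_resolution M n.
Proof.
pose g i := sval (cid (truncation_idempotent_ex i)).
have gP i : truncation_idempotent (g i) := svalP (cid (truncation_idempotent_ex i)).
have gg i x : g i (g i x) = g i x by case: (gP i).
have g0 i : (i < n)%N -> forall x, g i x = 0 by case: (gP i).
have gim i : (i <= n)%N -> forall x, exists w, g i x = d i w by case: (gP i).
have gd i : (n <= i)%N -> forall w, g i (d i w) = d i w by case: (gP i).
have gid i : (n < i)%N -> forall x, g i x = x by case: (gP i).
pose p i := sval (cid (kernel_projection (@gg i))).
have pE i x : val (p i x) = x - g i x := svalP (cid (kernel_projection (@gg i))) x.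
pose v i := sval (cid (kernel_inclusion (g i))).
have vE i x : v i x = val x := svalP (cid (kernel_inclusion (g i))) x.
have pv i : cancel (v i) (p i).
  by move=> x; apply: val_inj; rewrite pE vE kernelP subr0.
have dd i x : d i (d i.+1 x) = 0 by apply/exact_d; exists x.
have ed x : e (d 0%N x) = 0 by apply/exact_e; exists x.
have dg i x : (i < n)%N -> d i (g i.+1 x) = 0.
  by move=> /gim/(_ x)[w ->]; exact: dd.
have eg x : e (g 0%N x) = 0 by have [w ->] := gim 0%N (leq0n n) x; exact: ed.
(* A preimage may be moved into the kernel of [g i.+1]: for [i < n] the part removed is a boundary,
   and for [n <= i] the element [y] is zero, being both fixed and killed by [g i]. *)
have lift i (y : kernel (g i)) x : val y = d i x ->
    p i (d i (val (p i.+1 x))) = y.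
  move=> yE; apply: val_inj; rewrite pE pE linearB -yE.
  have [/dg ->|le_ni] := ltnP i n; first by rewrite subr0 kernelP subr0.
  rewrite (gid i.+1) // -yE subrr linear0 subr0.
  by have := kernelP y; rewrite yE gd // => ->.
exists (fun i => kernel (g i)), (fun i => p i \o d i \o v i.+1).
exists (e \o v 0%N); split=> //=.
- by move=> i; exact: projective_retract (@pv i) (@projP i).
- move=> y; have [x <-] := surj_e y; exists (p 0%N x).
  by rewrite /= vE pE linearB eg subr0.
- move=> y; rewrite /= vE; split=> [/exact_e[x /esym yE]|[x <-]].
    by exists (p 1%N x); rewrite /= vE; exact: lift.
  by rewrite /= pE vE linearB ed eg subr0.
- move=> i y; rewrite /= vE; split=> [dy|[x <-]].
    suff /exact_d[x /esym yE] : d i (val y) = 0.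
      by exists (p i.+2 x); rewrite /= vE; exact: lift.
    (* For [n <= i] the kernel containing [y] is zero; for [i < n] the projection [p i] is the
       identity. *)
    have [lt_in|le_ni] := ltnP i n; last first.
      by have := kernelP y; rewrite gid // => ->; rewrite linear0.
    by move/(congr1 val): dy; rewrite pE g0 // subr0.
  apply: val_inj; rewrite /= !pE !vE.
  have [lt_in|le_ni] := ltnP i n.
    by rewrite (g0 i) // subr0 linearB /= dd dg // subrr.
  by rewrite (gid i.+1) // subrr !linear0 addr0.
- move=> i lt_ni x; apply: val_inj.
  by have := kernelP x; rewrite gid.
Qed.

End Truncation.

(** * Vanishing of the finitistic dimension *)

Theorem corollary5p5 (K : fieldType) (A : falgType K)
  (hA : forall M : rmodType A, fin_gen M ->
          generated_torsion_class
            (fun I : rmodType A => fin_gen I /\ injective_module I) M) :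
  exists d : nat, Findim_le A^c d.
Proof.
exists 0%N => M [//|n] [[P [d [e [projP surj_e exact_e exact_d P0]]]] min_n].
(* The kernel of [d n] is the image of [d n.+1], whose source [P n.+2] is zero. *)
have d_inj : injective (d n).
  move=> x y dxy; apply/eqP; rewrite -subr_eq0; apply/eqP.
  have /exact_d[z <-] : d n (x - y) = 0 by rewrite linearB dxy subrr.
  by rewrite (P0 n.+2 _ z) // linear0.
have [_ EA] : fin_gen ((A^c)^o : rmodType A) /\ extends_along (d n) (A^c)^o.
  apply: (hA _ (fin_gen_regular A^c)
            (fun X => fin_gen X /\ extends_along (d n) X)).
    exact: extends_along_torsion (projP _) (projP _).
  (* Injective modules admit extensions along [d n] because [d n] is injective. *)
  by move=> I [gI injI]; split=> // f; exact: injI.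
have [h hK] := retraction_of_extends_along_regular (projP _) EA.
(* A resolution of length [n] contradicts the minimality of [n + 1]. *)
by have := min_n n (truncate_resolution projP surj_e exact_e exact_d hK);
  rewrite ltnn.
Qed.
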